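(* Let $U\subset B_U$ and $V\subset B_V$ be open convex subsets of Banach spaces, equip $B_U\times B_V$ with the max norm, and let $Z$ be a Banach space. Let $r,s\ge0$ with $t=r-s>0$. Then the map $\phi\mapsto\hat\phi$, where $\hat\phi_u(x):=\phi(u,x)$ for $u\in U$, $x\in V$, defines canonical continuous linear injections \[C^r(U\times V;Z)\hookrightarrow C^t(U;C^s(V;Z))\quad\text{and}\quad c^r(U\times V;Z)\hookrightarrow C^t(U;c^s(V;Z)).\]
   Context: Fix $\delta_1\in(0,1]$. For $W$ an open convex subset of a Banach space, a Banach space $Y$, and $r=k+\alpha$ with $k\in\mathbb{N}_0$, $\alpha\in(0,1]$, $C^r(W;Y)$ is the space of $k$ times Fréchet differentiable $\phi:W\to Y$ with finite norm $\|\phi\|_r=\max_{0\le q\le k}\sup_W\|D^q\phi\|\vee h(\phi)$, where $h(\phi)$ is the smallest $C$ with $\|D^k\phi(\xi)-D^k\phi(\xi')\|\le C\|\xi-\xi'\|^\alpha$ whenever $\|\xi-\xi'\|\le\delta_1$; $C^0$ denotes bounded continuous maps with the sup norm. $c^r(W;Y)$ is the closure in $C^r(W;Y)$ of $C^{r'}(W;Y)$ for $r'>r$ (independent of $r'$). *)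

(* Defs.v *)
From mathcomp Require Import all_boot all_algebra all_classical all_reals all_analysis.
Import GRing.Theory Num.Theory.
Import numFieldNormedType.Exports.
Set Implicit Arguments. Unset Strict Implicit. Unset Printing Implicit Defensive.
Local Open Scope classical_set_scope.
Local Open Scope ring_scope.

(* Generic setting:
   W : the normed space containing the (open convex) domain Om;
   Y : a real vector space of values, measured by an extended-real valued
       "norm" nY (nY y = +oo encodes "y is not in the target Banach space").
   A q-linear map on W with values in Y is a function ('I_q -> W) -> Y. *)
Section Holder.
Context {R : realType} {W : normedModType R} {Y : lmodType R}.
Variable (nY : Y -> \bar R).

Definition upd q (h : 'I_q -> W) (i : 'I_q) (v : W) : 'I_q -> W :=
  fun j => if j == i then v else h j.

Definition multilin q (L : ('I_q -> W) -> Y) : Prop :=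
  forall (h : 'I_q -> W) (i : 'I_q) (a : R) (x y : W),
    L (upd h i (a *: x + y)) = a *: L (upd h i x) + L (upd h i y).

Definition opnorm q (L : ('I_q -> W) -> Y) : \bar R :=
  ereal_sup [set nY (L h) | h in [set h : 'I_q -> W | forall i, `|h i| <= 1]].

Definition consv q (h : W) (v : 'I_q -> W) : 'I_q.+1 -> W :=
  fun j => if unlift ord0 j is Some j' then v j' else h.

(* G is the Frechet derivative of F (valued in bounded q-linear maps) at xi,
   relative to the open set Om; G xi (h, v) = (DF(xi) h) v. *)
Definition is_fderiv (Om : set W) q (F : W -> ('I_q -> W) -> Y)
    (G : W -> ('I_q.+1 -> W) -> Y) (xi : W) : Prop :=
  forall eps : R, 0 < eps -> exists2 del : R, 0 < del &
    forall h : W, Om (xi + h) -> `|h| < del ->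
      (opnorm (fun v => (F (xi + h) v - F xi v - G xi (consv h v))%R)
        <= (eps * `|h|)%:E)%E.

Definition derivs (Om : set W) (k : nat) (phi : W -> Y)
    (D : forall q : nat, W -> ('I_q -> W) -> Y) : Prop :=
  [/\ forall xi v, Om xi -> D 0%N xi v = phi xi,
      forall q, (q <= k)%N -> forall xi, Om xi ->
        multilin (D q xi) /\ (opnorm (D q xi) < +oo)%E
    & forall q, (q < k)%N -> forall xi, Om xi -> is_fderiv Om (D q) (D q.+1) xi].

(* r = k + alpha, k in N, alpha in (0,1], for r > 0 *)
Definition hk (r : R) : nat := (`|Num.ceil r|%N).-1.
Definition ha (r : R) : R := r - (hk r)%:R.

Variable (delta1 : R).

Definition supnorm (Om : set W) q (Dq : W -> ('I_q -> W) -> Y) : \bar R :=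
  maxe 0%E (ereal_sup [set opnorm (Dq xi) | xi in Om]).

Definition holder (Om : set W) (alpha : R) q (Dq : W -> ('I_q -> W) -> Y)
  : \bar R :=
  maxe 0%E (ereal_sup [set (opnorm (fun v => (Dq p.1 v - Dq p.2 v)%R)
                          * ((`|p.1 - p.2| `^ alpha)^-1)%:E)%E
     | p in [set p : W * W | [/\ Om p.1, Om p.2, p.1 != p.2
                              & `|p.1 - p.2| <= delta1]]]).

Definition Cnorm_of (Om : set W) (r : R) (D : forall q, W -> ('I_q -> W) -> Y)
  : \bar R :=
  maxe (\big[maxe/0%E]_(q < (hk r).+1) supnorm Om (D q))
       (holder Om (ha r) (D (hk r))).

Definition contOn (Om : set W) (phi : W -> Y) : Prop :=
  forall xi, Om xi -> forall eps : R, 0 < eps -> exists2 del : R, 0 < del &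
    forall xi', Om xi' -> `|xi - xi'| < del -> (nY (phi xi' - phi xi)%R < eps%:E)%E.

(* ||phi||_r ; equal to +oo when phi is not in C^r(Om;Y).
   r = 0 : bounded continuous maps with the sup norm. *)
Definition Cnorm (Om : set W) (r : R) (phi : W -> Y) : \bar R :=
  ereal_inf [set N : \bar R |
    (r <= 0 -> contOn Om phi /\ N = maxe 0%E (ereal_sup [set nY (phi xi) | xi in Om]))
    /\ (0 < r -> exists D, derivs Om (hk r) phi D /\ N = Cnorm_of Om r D)].

Definition inC (Om : set W) (r : R) (phi : W -> Y) : Prop :=
  (Cnorm Om r phi < +oo)%E.

Definition inc (Om : set W) (r : R) (phi : W -> Y) : Prop :=
  inC Om r phi /\
  forall eps : R, 0 < eps -> exists r' : R, r < r' /\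
    exists psi : W -> Y, inC Om r' psi /\
      (Cnorm Om r (fun xi => (phi xi - psi xi)%R) < eps%:E)%E.

End Holder.

(* restrict an extended norm to a subset: +oo outside P *)
Definition restrnorm {R : realType} {Y : Type} (P : Y -> Prop) (n : Y -> \bar R)
  (y : Y) : \bar R := ereal_inf [set N : \bar R | P y /\ N = n y].

Definition enorm {R : realType} {Z : normedModType R} (z : Z) : \bar R := (`|z|)%:E.

Definition hat {A B C : Type} (phi : A * B -> C) : A -> B -> C :=
  fun u x => phi (u, x).

(* Main.v *)
Require Import Defs.
From mathcomp Require Import all_boot all_order all_algebra all_classical all_reals all_analysis.
From mathcomp Require Import lra ring.
Import Order.TTheory GRing.Theory Num.Theory.
Import numFieldNormedType.Exports.
Local Open Scope classical_set_scope.
Local Open Scope ring_scope.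

(* Write r = k + al, s = l + be, t = r - s = m + ga, so that l + m <= k <= l + m + 1.
   The q-th derivative of [hat phi] is the partial derivative D_u^q phi, and its
   j-th derivative in x is D_x^j D_u^q phi.  By the mean value inequality
   all estimates reduce to the second difference of a derivative z of phi of order
   at most l + m, namely |Delta_x Delta_u z| <= 2 N |dx|^be |du|^ga: if z has order k,
   use the Hoelder bound in the shorter of the two directions; otherwise apply the
   mean value inequality in the shorter direction and the Hoelder bound of Dz in the
   other one.  Schwarz's theorem is needed to exchange D_u with D_x^j when bounding the
   Taylor remainder of [hat phi] in C^s.
   For the little Hoelder spaces, if psi in C^{r'} approximates phi in C^r, then
   D_u^q psi lies in C^{r' - t} and approximates D_u^q phi in C^s. *)

Set Implicit Arguments. Unset Strict Implicit. Unset Printing Implicit Defensive.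

(** * Jets indexed by lists of directions, and their relation to [Cnorm] *)

Section Jets.
Context {R : realType} {W : normedModType R} {Y : lmodType R}.
Implicit Types (Om : set W) (T : W -> seq W -> Y) (s : seq W).

Definition unit_seq s := all (fun x : W => `|x| <= 1) s.

Definition seq_multilin T := forall xi s1 s2 (a : R) x y,
  T xi (s1 ++ (a *: x + y) :: s2) =
  a *: T xi (s1 ++ x :: s2) + T xi (s1 ++ y :: s2).

(** The radius [del] is chosen before the directions [s], so the remainder is small uniformly over
    unit directions: this is Frechet differentiability in the operator norm. *)
Definition seq_deriv (nY : Y -> \bar R) Om k T := forall xi n, Om xi -> (n < k)%N ->
  forall eps : R, 0 < eps -> exists2 del : R, 0 < del &
    forall h s, size s = n -> unit_seq s -> Om (xi + h) -> `|h| < del ->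
      (nY (T (xi + h) s - T xi s - T xi (h :: s))%R <= (eps * `|h|)%:E)%E.

(* [T xi [:: h_1; ..; h_q]] stands for the q-th derivative at xi applied to
   (h_1, .., h_q); lists spare the casts between the types ['I_q -> W]. *)
Record jet (nY : Y -> \bar R) (delta1 : R) Om (r : R) T (M : R) : Prop := Jet {
  jet_ge0 : 0 <= M;
  jet_multilin : seq_multilin T;
  jet_deriv : seq_deriv nY Om (hk r) T;
  jet_bound : forall xi s, Om xi -> (size s <= hk r)%N -> unit_seq s ->
    (nY (T xi s) <= M%:E)%E;
  jet_holder : 0 < r -> forall xi xi' s, Om xi -> Om xi' -> xi != xi' ->
    `|xi - xi'| <= delta1 -> size s = hk r -> unit_seq s ->
    (nY (T xi s - T xi' s)%R <= (M * `|xi - xi'| `^ ha r)%:E)%E;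
  jet_cont : r <= 0 -> contOn nY Om (T ^~ [::]) }.

Definition seqv q (v : 'I_q -> W) := [seq v i | i <- enum 'I_q].

Lemma size_seqv q (v : 'I_q -> W) : size (seqv v) = q.
Proof. by rewrite size_map size_enum_ord. Qed.

Lemma seqv_consv q (h : W) (v : 'I_q -> W) : seqv (consv h v) = h :: seqv v.
Proof.
rewrite /seqv enum_ordSl /= {1}/consv unlift_none -map_comp; congr cons.
by apply: eq_map => i; rewrite /= /consv liftK.
Qed.

Lemma seqv_upd q (v : 'I_q -> W) (i : 'I_q) :
  exists s1 s2, forall z, seqv (upd v i z) = s1 ++ z :: s2.
Proof.
have iq : i \in enum 'I_q by rewrite mem_enum.
rewrite /seqv; have := enum_uniq 'I_q.
case/splitPr: iq => p1 p2; rewrite cat_uniq /= negb_or.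
move=> /and3P [_ /andP [ip1 _] /andP [ip2 _]].
exists (map v p1), (map v p2) => z; rewrite map_cat /= /upd eqxx.
congr (_ ++ _ :: _); apply/eq_in_map => j jp; case: eqP => // ji; move: jp.
  by rewrite ji (negPf ip1).
by rewrite ji (negPf ip2).
Qed.

Lemma unit_seqv q (v : 'I_q -> W) : (forall i, `|v i| <= 1) -> unit_seq (seqv v).
Proof. by move=> v1; rewrite /unit_seq all_map; apply/allP => i _ /=. Qed.

Lemma nth_consv s n (h : W) :
  consv h (fun i : 'I_n => nth 0 s i) = (fun i : 'I_n.+1 => nth 0 (h :: s) i).
Proof.
apply/funext => i; rewrite /consv.
by case: unliftP => [j ->|->].
Qed.

Lemma nth_upd s1 s2 x z n (i : 'I_n) : i = size s1 :> nat ->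
  upd (fun i : 'I_n => nth 0 (s1 ++ x :: s2) i) i z =
  (fun i : 'I_n => nth 0 (s1 ++ z :: s2) i).
Proof.
move=> i1; apply/funext => j; rewrite /upd -val_eqE /= i1 !nth_cat.
case: (ltngtP j (size s1)) => //= [js|->]; last by rewrite subnn.
by rewrite -(subnSK js).
Qed.

Lemma unit_seq_nth s i : unit_seq s -> `|nth 0 s i| <= 1.
Proof.
move=> us; case: (ltnP i (size s)) => ils; first exact: (allP us) _ (mem_nth _ ils).
by rewrite nth_default // normr0.
Qed.

(** [Cnorm] is an infimum over derivative families, so it suffices to exhibit one, here [T] read
    through [seqv]. *)
Lemma jet_Cnorm nY delta1 Om r T M phi : jet nY delta1 Om r T M ->
  (forall xi, Om xi -> T xi [::] = phi xi) ->
  (Cnorm nY delta1 Om r phi <= M%:E)%E.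
Proof.
case=> M0 Tlin Tder Tbd Thol Tcont Tphi; apply: ge_ereal_inf.
case: (leP r 0) => r0.
  exists (maxe 0%E (ereal_sup [set nY (phi xi) | xi in Om])).
    split=> // _; split=> // xi Omxi e e0.
    have [d d0 dP] := Tcont r0 xi Omxi e e0; exists d => // xi' Omxi' xx'.
    by rewrite -!Tphi //; exact: dP.
  rewrite ge_max lee_fin M0 /=; apply: ge_ereal_sup => _ [xi Omxi <-].
  by rewrite -Tphi //; exact: Tbd.
pose D q xi (v : 'I_q -> W) := T xi (seqv v).
have opD q xi : Om xi -> (q <= hk r)%N -> (opnorm nY (D q xi) <= M%:E)%E.
  move=> Omxi qk; apply: ge_ereal_sup => _ [v v1 <-].
  by apply: Tbd => //; rewrite ?size_seqv //; exact: unit_seqv.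
exists (Cnorm_of nY delta1 Om r D).
  split=> [//|_].
  exists D; split=> //; split.
  - by move=> xi v Omxi; rewrite /D -Tphi //; congr T; apply: size0nil; rewrite size_seqv.
  - move=> q qk xi Omxi; split; last exact: le_lt_trans (opD q xi Omxi qk) (ltry _).
    move=> v i a x y; have [s1 [s2 E]] := seqv_upd v i.
    by rewrite /D !E; exact: Tlin.
  - move=> q qk xi Omxi e e0; have [d d0 dP] := Tder xi q Omxi qk e e0.
    exists d => // h Omh hd; apply: ge_ereal_sup => _ [v v1 <-].
    rewrite /D seqv_consv; apply: dP => //; first exact: size_seqv.
    exact: unit_seqv.
rewrite ge_max; apply/andP; split.
  apply: bigmax_le => [|q _]; first by rewrite lee_fin.
  rewrite ge_max lee_fin M0 /=; apply: ge_ereal_sup => _ [xi Omxi <-].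
  by apply: opD => //; rewrite -ltnS.
rewrite ge_max lee_fin M0 /=; apply: ge_ereal_sup => _ [[x y] /= [Omx Omy xy xyd] <-].
rewrite lee_pdivrMr; last by apply: powR_gt0; rewrite normr_gt0 subr_eq0.
apply: ge_ereal_sup => _ [v v1 <-]; apply: Thol => //; first exact: size_seqv.
exact: unit_seqv.
Qed.

(** An infimum strictly below [M] is approached by a family whose norm is still below [M]. The value
    identity is wanted at every [xi], also off [Om], because the curried map takes values in
    functions on all of [BV]. *)
Lemma Cnorm_jet nY delta1 Om r M phi : 0 <= r ->
  (Cnorm nY delta1 Om r phi < M%:E)%E ->
  exists2 T, jet nY delta1 Om r T M & forall xi, T xi [::] = phi xi.
Proof.
move=> r_ge0 /ereal_inf_ltP [N [Nr0 Nr] NM].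
case: (leP r 0) => r0.
  have [phic NE] := Nr0 r0; move: NM; rewrite {}NE gt_max => /andP [M0 supM].
  have rE : r = 0 by apply/le_anti; rewrite r0 r_ge0.
  have hkr : hk r = 0%N by rewrite /hk rE ceil0.
  (* Since [hk r = 0] here, bounds only concern the empty list; the value 0 on longer lists keeps
     multilinearity. *)
  exists (fun xi s => if nilp s then phi xi else 0) => //; split=> //.
  - exact: ltW.
  - by move=> xi s1 s2 a x y; rewrite /nilp !size_cat !addnS /= scaler0 addr0.
  - by move=> xi n; rewrite hkr.
  - move=> xi s Omxi; rewrite hkr leqn0 /nilp => /eqP -> _ /=.
    by apply: le_trans (ltW supM); apply: ereal_sup_ubound; exists xi.
  - by move=> r0'; move: r0; rewrite leNgt r0'.
have [D [[D0 Dop Dder] NE]] := Nr r0; move: NM; rewrite {}NE.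
rewrite gt_max => /andP [supM holM].
have M0 : 0 < M.
  by rewrite -lte_fin; apply: le_lt_trans supM; exact: bigmax_ge_id.
(* Extending by 0 off Om makes T multilinear at every point, which is needed to
   regard [x |-> T (u, x) _] as an element of the vector space BV -> Z. *)
pose T xi s := if nilp s then phi xi else
  if `[< Om xi >] && (size s <= hk r)%N
  then D (size s) xi (fun i => nth 0 s i) else 0.
have TD n xi s : Om xi -> (n <= hk r)%N -> size s = n ->
    T xi s = D n xi (fun i => nth 0 s i).
  move=> Omxi nk sn; rewrite /T /nilp sn.
  have -> : `[< Om xi >] by apply/asboolP.
  case: eqP => [n0|_]; last by rewrite nk /=; move: sn nk => <-.
  by move: n0 nk sn => -> _ _; rewrite D0.
exists T => //; split.
- exact: ltW.
- move=> xi s1 s2 a x y; rewrite /T /nilp.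
  have E z : size (s1 ++ z :: s2) = (size s1 + size s2).+1.
    by rewrite size_cat /= addnS.
  rewrite !E /=; case: ifP => [/andP [/asboolP Omxi nk]|_]; last by rewrite scaler0 addr0.
  have [lin _] := Dop _ nk xi Omxi.
  have i1 : (size s1 < (size s1 + size s2).+1)%N by rewrite ltnS leq_addr.
  have := lin (fun i => nth 0 (s1 ++ x :: s2) i) (Ordinal i1) a x y.
  by rewrite !nth_upd.
- move=> xi n Omxi nk e e0; have [d d0 dP] := Dder n nk xi Omxi e e0.
  exists d => // h s sn us Omh hd; apply: le_trans (dP h Omh hd).
  apply: ereal_sup_ubound; exists (fun i => nth 0 s i).
    by move=> i; exact: unit_seq_nth.
  by rewrite (TD n) // 1?ltnW // (TD n) // 1?ltnW // (TD n.+1) /= ?sn // nth_consv.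
- move=> xi s Omxi sk us; apply: le_trans (ltW supM); rewrite (TD (size s)) //.
  rewrite -ltnS in sk; apply: (@bigmax_sup _ _ _ _ (Ordinal sk)) => //=.
  rewrite le_max; apply/orP; right.
  apply: (@le_trans _ _ (opnorm nY (D (size s) xi))).
    apply: ereal_sup_ubound; exists (fun i => nth 0 s i) => //.
    by move=> i; exact: unit_seq_nth.
  by apply: ereal_sup_ubound; exists xi.
- move=> _ xi xi' s Omxi Omxi' xx' xd sk us; rewrite EFinM -lee_pdivrMr; last first.
    by apply: powR_gt0; rewrite normr_gt0 subr_eq0.
  apply: le_trans (ltW holM); rewrite le_max; apply/orP; right.
  apply: (@le_trans _ _ (opnorm nY (fun v => (D (hk r) xi v - D (hk r) xi' v)%R)
     * ((`|xi - xi'| `^ ha r)^-1)%:E)%E).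
    apply: lee_wpmul2r; first by rewrite lee_fin invr_ge0 powR_ge0.
    apply: ereal_sup_ubound; exists (fun i => nth 0 s i).
      by move=> i; exact: unit_seq_nth.
    by rewrite !(TD (hk r)).
  by apply: ereal_sup_ubound; exists (xi, xi').
- by move=> r0'; move: r0; rewrite ltNge r0'.
Qed.

End Jets.

(** * Arithmetic of the integer and fractional parts, and powers of small numbers *)

Section Exponents.
Context {R : realType}.
Implicit Types r s a b : R.

(** For [r > 0] the ceiling is some [n + 1] and [hk r = n], with [n < r <= n + 1]; the predecessor
    therefore never truncates at 0. *)
Lemma ha_gt0 r : 0 < r -> 0 < ha r.
Proof.
rewrite /ha /hk => r0; have := ceil_itv r; have : 0 < Num.ceil r by rewrite ceil_gt0.
case: (Num.ceil r) => [[|n]|n] // _ /andP [+ _].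
have -> : (n.+1 : int) - 1 = n by rewrite -addn1 PoszD addrK.
by rewrite /= subr_gt0.
Qed.

Lemma ha_le1 r : 0 < r -> ha r <= 1.
Proof.
rewrite /ha /hk => r0; have := ceil_itv r; have : 0 < Num.ceil r by rewrite ceil_gt0.
case: (Num.ceil r) => [[|n]|n] // _ /andP [_ +].
by rewrite /= lerBlDl natr1.
Qed.

Lemma hk0 : hk (0 : R) = 0%N. Proof. by rewrite /hk ceil0. Qed.

Lemma ha0 : ha (0 : R) = 0. Proof. by rewrite /ha hk0 subr0. Qed.

Lemma ha_ge0_le1 s : 0 <= s -> 0 <= ha s <= 1.
Proof.
rewrite le_eqVlt => /predU1P [<-|s0]; first by rewrite ha0 lexx ler01.
by rewrite ltW ?ha_gt0 // ha_le1.
Qed.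

Lemma hk_ha_split r s : 0 <= s -> 0 < r - s ->
  [/\ (hk s + hk (r - s) <= hk r)%N,
      hk s + hk (r - s) = hk r -> ha r = ha s + ha (r - s)
    & ha s + ha (r - s) - 1 <= ha r].
Proof.
move=> s0 t0; have r0 : 0 < r by lra.
have /andP [b0 b1] := ha_ge0_le1 s0.
have := ha_gt0 r0; have := ha_le1 r0; have := ha_gt0 t0; have := ha_le1 t0.
move: b0 b1; rewrite /ha; move: (hk r) (hk s) (hk (r - s)) => k l m *.
split.
- rewrite leqNgt; apply/negP; rewrite -(ler_nat R) -natr1 natrD; lra.
- by move=> <-; rewrite natrD; lra.
- suff : (k <= (l + m).+1)%N by rewrite -(ler_nat R) -natr1 natrD; lra.
  by rewrite leqNgt; apply/negP; rewrite -(ler_nat R) -!natr1 natrD; lra.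
Qed.

Lemma hk_ha_mono r s : 0 < s -> s <= r ->
  (hk s <= hk r)%N /\ (hk s = hk r -> ha s <= ha r).
Proof.
move=> s0 sr; have r0 : 0 < r by lra.
have := ha_gt0 r0; have := ha_le1 r0; have := ha_gt0 s0; have := ha_le1 s0.
rewrite /ha; move: (hk r) (hk s) => k l *; split; last by move=> ->; lra.
by rewrite leqNgt; apply/negP; rewrite -(ler_nat R) -natr1; lra.
Qed.

(** Write [a] as [a ^ ga] times [a ^ (1 - ga)], replace the base of the second factor by [b], and
    compare exponents using [b <= 1]. This turns a Lipschitz gain in the shorter direction into the
    mixed gain of a second difference. *)
Lemma powR_interpolate a b (al be ga : R) : 0 < a -> a <= b -> b <= 1 ->
  ga <= 1 -> be + ga - 1 <= al -> a * b `^ al <= a `^ ga * b `^ be.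
Proof.
move=> a0 ab b1 ga1 albe; have b0 : 0 < b by exact: lt_le_trans ab.
have aE : a = a `^ ga * a `^ (1 - ga).
  rewrite -powRD; last by rewrite (gt_eqF a0) implybT.
  by rewrite subrKC powRr1 // ltW.
rewrite {1}aE -mulrA ler_wpM2l ?powR_ge0 //.
apply: (@le_trans _ _ (b `^ (1 - ga) * b `^ al)).
  by rewrite ler_wpM2r ?powR_ge0 // ge0_ler_powR ?nnegrE ?subr_ge0 // ltW.
rewrite -powRD; last by rewrite (gt_eqF b0) implybT.
by apply: ger_powR; rewrite ?b0 //; lra.
Qed.

Lemma le_powR_self a b : 0 <= a -> a <= 1 -> b <= 1 -> 0 <= b -> a <= a `^ b.
Proof.
rewrite le_eqVlt => /predU1P [<-|a0] a1 b1 b0; first exact: powR_ge0.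
by apply: ger1_powR; rewrite ?a0.
Qed.

Lemma le_powR_exp a b c : 0 < a -> a <= 1 -> b <= c -> a `^ c <= a `^ b.
Proof. by move=> a0 a1 bc; apply: ger_powR => //; rewrite a0. Qed.

Lemma powR_small al e : 0 < al -> 0 < e ->
  exists2 d : R, 0 < d & forall x, 0 <= x -> x <= d -> x `^ al <= e.
Proof.
move=> al0 e0; exists (e `^ al^-1); first exact: powR_gt0.
move=> x x0 xd; apply: (@le_trans _ _ ((e `^ al^-1) `^ al)).
  by rewrite ge0_ler_powR ?nnegrE ?powR_ge0 // ltW.
by rewrite -powRrM mulVf ?gt_eqF // powRr1 // ltW.
Qed.

End Exponents.

(** Interchanges the two increments of a second difference. *)
Lemma subrACA (A : zmodType) (x y z t : A) : x - y - (z - t) = x - z - (y - t).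
Proof. by rewrite !opprD !opprK addrACA. Qed.

(** * The mean value inequality for vector-valued paths *)

Section MeanValue.
Context {R : realType} {Z : normedModType R}.
Implicit Types (f g : R -> Z).

(** Differentiability is relative to [0, 1], hence one-sided at the end points, because a segment is
    only known to stay in the domain for these parameters. *)
Definition path_deriv g g' := forall th : R, 0 <= th <= 1 ->
  forall e : R, 0 < e -> exists2 d : R, 0 < d & forall ta : R, 0 <= ta <= 1 ->
    `|ta - th| < d -> `|g ta - g th - (ta - th) *: g' th| <= e * `|ta - th|.

Lemma path_derivB f f' g g' : path_deriv f f' -> path_deriv g g' ->
  path_deriv (fun x => f x - g x) (fun x => f' x - g' x).
Proof.
move=> df dg th th01 e e0; have e20 : 0 < e / 2 by rewrite divr_gt0.
have [d1 d10 d1P] := df th th01 _ e20; have [d2 d20 d2P] := dg th th01 _ e20.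
exists (Num.min d1 d2); first by rewrite lt_min d10.
move=> ta ta01; rewrite lt_min => /andP [h1 h2].
have := d1P ta ta01 h1; have := d2P ta ta01 h2; set X := g ta - _ - _; set X' := f ta - _ - _.
move=> XE X'E; have -> : f ta - g ta - (f th - g th) - (ta - th) *: (f' th - g' th) = X' - X.
  by rewrite /X /X' scalerBr [f ta - g ta - _]subrACA; exact: subrACA.
apply: le_trans (ler_normB _ _) _; lra.
Qed.

Lemma path_deriv_scale (c : Z) : path_deriv (fun x => x *: c) (fun=> c).
Proof.
move=> th _ e e0; exists 1 => // ta _ _.
by rewrite -scalerBl subrr normr0 mulr_ge0 // ltW.
Qed.

(** Continuous induction along [0, 1] with slope [M + e]: the slack [e] absorbs the local
    differentiation error and is finally sent to 0. *)
Lemma mean_value_ineq g g' (M : R) : path_deriv g g' ->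
  (forall th : R, 0 <= th <= 1 -> `|g' th| <= M) -> `|g 1 - g 0| <= M.
Proof.
move=> dg gM; apply/ler_addgt0Pr => e e0.
have M0 : 0 <= M by apply: le_trans (gM 0 _); rewrite ?lexx ?ler01.
have loc c : 0 <= c <= 1 -> exists2 d : R, 0 < d & forall ta : R, 0 <= ta <= 1 ->
    `|ta - c| < d -> `|g ta - g c| <= (M + e) * `|ta - c|.
  move=> c01; have [d d0 dP] := dg c c01 e e0; exists d => // ta ta01 tac.
  rewrite mulrDl -[g ta - g c](subrK ((ta - c) *: g' c)) addrC.
  apply: le_trans (ler_normD _ _) _; apply: lerD; last exact: dP.
  by rewrite normrZ mulrC ler_wpM2r // gM.
(* The supremum of S belongs to S and, by [loc], cannot be less than 1. *)
pose S := [set x : R | 0 <= x <= 1 /\ `|g x - g 0| <= (M + e) * x].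
have S0 : S 0 by split; rewrite ?lexx ?ler01 // subrr normr0 mulr0.
have Sub : ubound S 1 by move=> x [/andP []].
have hsS : has_sup S by split; [exists 0|exists 1].
set c := sup S.
have c01 : 0 <= c <= 1.
  by apply/andP; split; [apply: sup_upper_bound|apply: sup_le_ub => //; exists 0].
have Sc : S c.
  split=> //; have [d d0 dP] := loc c c01.
  have [x Sx xc] := sup_adherent d0 hsS.
  have xlec : x <= c by exact: sup_upper_bound.
  have [x01 gx] := Sx; have := dP x x01; rewrite ler0_norm; last by lra.
  have -> : g c - g 0 = (g x - g 0) - (g x - g c).
    by rewrite opprB [RHS]addrC subrKA.
  move=> H; apply: le_trans (ler_normB _ _) _.
  have H' : `|g x - g c| <= (M + e) * - (x - c) by apply: H; rewrite /c; lra.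
  apply: le_trans (lerD gx H') _; rewrite -mulrDr; apply: ler_wpM2l; lra.
have [c1|c1] := ltP c 1; last first.
  have cE : c = 1 by apply/le_anti; rewrite c1 andbT; case/andP: c01.
  by case: Sc => _; rewrite cE mulr1.
have [d d0 dP] := loc c c01.
pose x := Num.min 1 (c + d / 2).
have cx : c < x by rewrite lt_min c1 /= ltrDl divr_gt0.
have xd : x - c < d.
  have : x <= c + d / 2 by rewrite ge_min lexx orbT.
  lra.
have x01 : 0 <= x <= 1.
  rewrite ge_min lexx andbT; case/andP: c01 => *; exact: le_trans (ltW cx).
have : S x.
  split=> //; have -> : g x - g 0 = (g c - g 0) + (g x - g c).
    by rewrite [RHS]addrC subrKA.
  have := dP x x01; rewrite ger0_norm; last by rewrite subr_ge0 ltW.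
  move=> /(_ xd) H.
  apply: le_trans (ler_normD _ _) _; case: Sc => _ gc.
  by apply: le_trans (lerD gc H) _; rewrite -mulrDr subrKC.
by move=> /(sup_upper_bound hsS) /le_lt_trans /(_ cx); rewrite ltxx.
Qed.

End MeanValue.

(** * Uniqueness and symmetry of the derivatives of a jet *)

Section NormedJets.
Context {R : realType} {W Z : normedModType R}.
Implicit Types (Om : set W) (T : W -> seq W -> Z) (s z : seq W).

Lemma enorm_le (y : Z) (M : R) : (enorm y <= M%:E)%E = (`|y| <= M).
Proof. by rewrite /enorm lee_fin. Qed.

Lemma multilin_headD T xi x y s : seq_multilin T ->
  T xi ((x + y) :: s) = T xi (x :: s) + T xi (y :: s).
Proof. by move=> lin; have := lin xi [::] s 1 x y; rewrite /= !scale1r. Qed.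

Lemma multilin_head0 T xi s : seq_multilin T -> T xi (0 :: s) = 0.
Proof.
move=> lin; apply: (@addrI _ (T xi (0 :: s))).
by rewrite -multilin_headD // !addr0.
Qed.

Lemma multilin_headZ T xi a x s : seq_multilin T ->
  T xi ((a *: x) :: s) = a *: T xi (x :: s).
Proof.
by move=> lin; have := lin xi [::] s a x 0; rewrite /= multilin_head0 // !addr0.
Qed.

(** Jets are controlled in unit directions only; normalizing [h] extends such a bound to all
    directions. *)
Lemma homogeneous_bound (f : W -> Z) (B : R) : (forall a x, f (a *: x) = a *: f x) ->
  (forall x, `|x| <= 1 -> `|f x| <= B) -> forall h, `|f h| <= `|h| * B.
Proof.
move=> fZ fB h; have [->|h0] := eqVneq h 0.
  by rewrite -(scale0r 0) fZ scale0r normr0 scale0r normr0 mul0r.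
have hE : h = `|h| *: (`|h|^-1 *: h) by rewrite scalerA divff ?scale1r ?normr_eq0.
rewrite {1}hE fZ normrZ normr_id ler_wpM2l // fB //.
by rewrite normrZ normfV normr_id mulVf ?normr_eq0.
Qed.

(** Tolerances are divided by [|h| + 1] instead of [|h|] so that [h = 0] needs no separate
    treatment. *)
Lemma frac_norm_le (e t : R) (h : W) : 0 <= e -> 0 <= t ->
  e / (`|h| + 1) * (t * `|h|) <= e * t.
Proof.
move=> e0 t0; have h1 : 0 < `|h| + 1 by rewrite ltr_wpDl.
have -> : e / (`|h| + 1) * (t * `|h|) = e * t * (`|h| / (`|h| + 1)) by ring.
by rewrite ler_piMr ?mulr_ge0 // ler_pdivrMr // mul1r lerDl.
Qed.

Lemma open_translate Om xi : open Om -> Om xi ->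
  exists2 rho : R, 0 < rho & forall v, `|v| < rho -> Om (xi + v).
Proof.
move=> oOm Omxi; have /nbhs_ballP [rho /= rho0 rhoP] := open_nbhs_nbhs (conj oOm Omxi).
exists rho => // v vr; apply: rhoP; rewrite -ball_normE /=.
by rewrite opprD addNKr normrN.
Qed.

Lemma path_deriv_seq k T Om xi h s : seq_multilin T ->
  seq_deriv (@enorm R Z) Om k T -> (size s < k)%N -> unit_seq s ->
  (forall th : R, 0 <= th <= 1 -> Om (xi + th *: h)) ->
  path_deriv (fun th => T (xi + th *: h) s) (fun th => T (xi + th *: h) (h :: s)).
Proof.
move=> lin der sk us seg th th01 e e0.
have h1 : 0 < `|h| + 1 by rewrite ltr_wpDl.
have [d d0 dP] := der _ _ (seg _ th01) sk (e / (`|h| + 1)) (divr_gt0 e0 h1).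
exists (d / (`|h| + 1)); first exact: divr_gt0.
move=> ta ta01; rewrite ltr_pdivlMr // => tad.
have E : xi + ta *: h = xi + th *: h + (ta - th) *: h.
  by rewrite -addrA -scalerDl subrKC.
have := dP ((ta - th) *: h) s erefl us; rewrite -E => /(_ (seg _ ta01)).
rewrite enorm_le multilin_headZ // normrZ => H; apply: le_trans (H _) _.
  by apply: le_lt_trans tad; rewrite ler_wpM2l // lerDl.
by apply: frac_norm_le => //; exact: ltW.
Qed.

(** Both first-order remainders at [xi + ta *: h] are small against [ta], and the difference of the
    derivatives is homogeneous in [h], so [ta] cancels. Two different lists [s], [s'] are allowed so
    that the lemma can differentiate a symmetry relation. *)
Lemma seq_deriv_unique k T T' Om xi h s s' : open Om ->
  seq_multilin T -> seq_deriv (@enorm R Z) Om k T ->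
  seq_multilin T' -> seq_deriv (@enorm R Z) Om k T' ->
  (size s < k)%N -> size s' = size s -> unit_seq s -> unit_seq s' -> Om xi ->
  (forall eta, Om eta -> T eta s = T' eta s') -> T xi (h :: s) = T' xi (h :: s').
Proof.
move=> oOm lin der lin' der' sk ss' us us' Omxi E.
apply/eqP; rewrite -subr_eq0 -normr_le0; apply/ler_addgt0Pr => e e0; rewrite add0r.
have h1 : 0 < `|h| + 1 by rewrite ltr_wpDl.
have [rho rho0 rhoP] := open_translate oOm Omxi.
have e20 : 0 < e / 2 / (`|h| + 1) by rewrite !divr_gt0.
have [d d0 dP] := der _ _ Omxi sk _ e20.
have [d' d'0 d'P] := der' _ _ Omxi sk _ e20.
pose m := Num.min rho (Num.min d d').
have m0 : 0 < m by rewrite !lt_min rho0 d0 d'0.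
(* This scaling brings an arbitrary [h] within all three radii. *)
pose ta := m / (`|h| + 1) / 2; have ta0 : 0 < ta by rewrite !divr_gt0.
have tah : `|ta *: h| < m.
  rewrite normrZ gtr0_norm //; apply: (@lt_le_trans _ _ (m / (`|h| + 1) * (`|h| + 1))).
    apply: (@lt_le_trans _ _ (ta * (`|h| + 1))); first by rewrite ltr_pM2l // ltrDl.
    rewrite ler_pM2r // /ta; have : 0 < m / (`|h| + 1) by exact: divr_gt0.
    lra.
  by rewrite divfK // gt_eqF.
move: (tah); rewrite !lt_min => /and3P [tr td td'].
have Omh := rhoP _ tr.
have := dP _ s erefl us Omh td; have := d'P _ s' ss' us' Omh td'.
rewrite !enorm_le !multilin_headZ // -!E // normrZ (gtr0_norm ta0).
set X := T _ s - _; move=> H1 H2.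
have H3 : ta * `|T xi (h :: s) - T' xi (h :: s')| <= ta * e.
  rewrite -{1}(gtr0_norm ta0) -normrZ.
  have -> : ta *: (T xi (h :: s) - T' xi (h :: s')) =
      (X - ta *: T' xi (h :: s')) - (X - ta *: T xi (h :: s)).
    by rewrite subrACA subrr sub0r opprB scalerBr.
  apply: le_trans (ler_normB _ _) _; apply: le_trans (lerD H1 H2) _.
  have := @frac_norm_le (e / 2) ta h (divr_ge0 (ltW e0) (ler0n _ 2)) (ltW ta0).
  lra.
by rewrite -(ler_pM2l ta0).
Qed.

(* The left-hand difference is symmetric in a and b, whence [schwarz]. *)
Lemma second_diff_deriv k T Om xi a b s : open Om -> seq_multilin T ->
  seq_deriv (@enorm R Z) Om k T -> ((size s).+1 < k)%N -> unit_seq s -> Om xi ->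
  `|a| <= 1 -> `|b| <= 1 -> forall e : R, 0 < e -> exists2 t0 : R, 0 < t0 &
  forall t, 0 < t -> t <= t0 ->
  `|T (xi + t *: a + t *: b) s - T (xi + t *: a) s - (T (xi + t *: b) s - T xi s)
    - t ^+ 2 *: T xi (a :: b :: s)| <= 4 * e * t ^+ 2.
Proof.
move=> oOm lin der sk us Omxi a1 b1 e e0.
have [rho rho0 rhoP] := open_translate oOm Omxi.
have [d d0 dP] := der _ _ Omxi sk _ e0.
pose m := Num.min rho d; have m0 : 0 < m by rewrite lt_min rho0 d0.
(* All increments from [xi] below have norm at most [2 * t], which is less than [m] when
   [t <= m / 3]. *)
exists (m / 3) => [|t t0 tm]; first by rewrite divr_gt0.
have ubs : unit_seq (b :: s) by rewrite /= b1.
have near v : `|v| <= 2 * t -> Om (xi + v) /\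
    `|T (xi + v) (b :: s) - T xi (b :: s) - T xi (v :: b :: s)| <= e * (2 * t).
  move=> vt; have : `|v| < m by apply: le_lt_trans vt _; lra.
  rewrite lt_min => /andP [vr vd]; have Omv := rhoP _ vr; split=> //.
  rewrite -enorm_le; apply: le_trans (dP v (b :: s) erefl ubs Omv vd) _.
  by rewrite lee_fin ler_wpM2l // ltW.
have tb1 (th : R) : 0 <= th <= 1 -> `|th *: (t *: b)| <= t.
  move=> /andP [th0 th1]; rewrite !normrZ (ger0_norm th0) (gtr0_norm t0).
  rewrite -[leRHS]mul1r; apply: ler_pM => //; first by rewrite mulr_ge0 // ltW.
  by rewrite ler_piMr // ltW.
have tab (th : R) : 0 <= th <= 1 -> `|t *: a + th *: (t *: b)| <= 2 * t.
  move=> th01; apply: le_trans (ler_normD _ _) _.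
  rewrite mulrDl mul1r; apply: lerD; last exact: tb1.
  by rewrite normrZ (gtr0_norm t0) ler_piMr // ltW.
have tb2 (th : R) : 0 <= th <= 1 -> `|th *: (t *: b)| <= 2 * t.
  by move=> th01; apply: le_trans (tb1 _ th01) _; lra.
pose X := T xi (a :: b :: s).
(* The mean value inequality is applied along [t *: b] to the increment in the direction [t *: a]
   minus its expected linear part. The derivative of this path is [t] times a difference of two
   first-order remainders, each at most [e * (2 * t)], which gives [4 * e * t ^+ 2]. *)
have P1 := path_deriv_seq (xi := xi + t *: a) (h := t *: b) lin der (ltnW sk) us.
have P2 := path_deriv_seq (xi := xi) (h := t *: b) lin der (ltnW sk) us.
have {P1 P2} P := path_derivB (path_derivB (P1 _) (P2 _)) (path_deriv_scale (t ^+ 2 *: X)).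
rewrite subrACA addrAC; have /= := mean_value_ineq (M := 4 * e * t ^+ 2) (P _ _).
rewrite !scale1r !scale0r !addr0 subr0; apply.
- by move=> th th01; rewrite -addrA; case: (near _ (tab _ th01)).
- by move=> th th01; case: (near _ (tb2 _ th01)).
move=> th th01; rewrite !multilin_headZ //.
have [_ H1] := near _ (tab _ th01); have [_ H2] := near _ (tb2 _ th01).
set h1 := t *: a + _ in H1; set h2 := th *: _ in H2.
have E : T xi (h1 :: b :: s) - T xi (h2 :: b :: s) = t *: X.
  by rewrite /h1 multilin_headD // addrK multilin_headZ.
have -> : t *: T (xi + t *: a + h2) (b :: s) - t *: T (xi + h2) (b :: s) - t ^+ 2 *: X
   = t *: ((T (xi + h1) (b :: s) - T xi (b :: s) - T xi (h1 :: b :: s)) -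
      (T (xi + h2) (b :: s) - T xi (b :: s) - T xi (h2 :: b :: s))).
  rewrite expr2 -scalerA -!scalerBr; congr (_ *: _).
  have -> : xi + t *: a + h2 = xi + h1 by rewrite /h1 addrA.
  by rewrite -E [RHS]subrACA [A in _ = A - _]subrACA subrr subr0.
rewrite normrZ (gtr0_norm t0); apply: (@le_trans _ _ (t * (e * (2 * t) + e * (2 * t)))).
  rewrite ler_pM2l //; apply: le_trans (ler_normB _ _) _; exact: lerD.
by rewrite expr2; lra.
Qed.

Lemma ge_minl (x y : R) : Num.min x y <= x.
Proof. by rewrite ge_min lexx. Qed.

Lemma ge_minr (x y : R) : Num.min x y <= y.
Proof. by rewrite ge_min lexx orbT. Qed.

Lemma schwarz k T Om xi a b s : open Om -> seq_multilin T ->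
  seq_deriv (@enorm R Z) Om k T -> ((size s).+1 < k)%N -> unit_seq s -> Om xi ->
  `|a| <= 1 -> `|b| <= 1 -> T xi (a :: b :: s) = T xi (b :: a :: s).
Proof.
move=> oOm lin der sk us Omxi a1 b1.
apply/eqP; rewrite -subr_eq0 -normr_le0; apply/ler_addgt0Pr => e e0; rewrite add0r.
(* Two errors of [4 * (e / 8) * t ^+ 2] add up to [e * t ^+ 2]. *)
have e80 : 0 < e / 8 by rewrite divr_gt0.
have [t1 t10 t1P] := second_diff_deriv oOm lin der sk us Omxi a1 b1 e80.
have [t2 t20 t2P] := second_diff_deriv oOm lin der sk us Omxi b1 a1 e80.
pose t := Num.min t1 t2; have t0 : 0 < t by rewrite lt_min t10.
have := t1P t t0 (ge_minl _ _); have := t2P t t0 (ge_minr _ _).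
rewrite [xi + t *: b + _]addrAC [A in A - _ *: T xi (b :: _)]subrACA.
set X := T (xi + t *: a + t *: b) s - _ - _ => H2 H1.
have t20' : 0 < t ^+ 2 by rewrite exprn_gt0.
have H3 : t ^+ 2 * `|T xi (a :: b :: s) - T xi (b :: a :: s)| <= t ^+ 2 * e.
  rewrite -{1}(gtr0_norm t20') -normrZ.
  have -> : t ^+ 2 *: (T xi (a :: b :: s) - T xi (b :: a :: s)) =
      (X - t ^+ 2 *: T xi (b :: a :: s)) - (X - t ^+ 2 *: T xi (a :: b :: s)).
    by rewrite subrACA subrr sub0r opprB scalerBr.
  apply: le_trans (ler_normB _ _) _; apply: le_trans (lerD H2 H1) _.
  by lra.
by rewrite -(ler_pM2l t20').
Qed.

Lemma unit_seq_cat s1 s2 : unit_seq (s1 ++ s2) = unit_seq s1 && unit_seq s2.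
Proof. exact: all_cat. Qed.

Lemma unit_seq_cons x s : unit_seq (x :: s) = (`|x| <= 1) && unit_seq s.
Proof. by []. Qed.

(** Schwarz's theorem exchanges the two leading directions; a further prefix is reached by
    differentiating the equality, which must therefore hold on all of [Om]. *)
Lemma seq_deriv_swap k T Om a b s1 s2 : open Om -> seq_multilin T ->
  seq_deriv (@enorm R Z) Om k T -> (size (s1 ++ a :: b :: s2) <= k)%N ->
  unit_seq (s1 ++ a :: b :: s2) ->
  forall xi, Om xi -> T xi (s1 ++ a :: b :: s2) = T xi (s1 ++ b :: a :: s2).
Proof.
move=> oOm lin der; elim: s1 => [|c s1 IH] /= sk us xi Omxi.
  by case/and3P: us => a1 b1 us; exact: (schwarz oOm lin der).
have /andP [c1 us1] := us.
apply: (seq_deriv_unique _ oOm lin der lin der) => //.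
- by rewrite !size_cat.
- move: us1; rewrite !unit_seq_cat !unit_seq_cons.
  by case: (unit_seq s1) => //=; rewrite andbCA.
- by move=> eta Ometa; apply: IH => //; exact: ltnW.
Qed.

(** Adjacent swaps carry [h] across [w], each passed entry joining the prefix [p]. *)
Lemma seq_deriv_move k T Om h p w v : open Om -> seq_multilin T ->
  seq_deriv (@enorm R Z) Om k T -> (size (p ++ h :: w ++ v) <= k)%N ->
  unit_seq (p ++ h :: w ++ v) ->
  forall xi, Om xi -> T xi (p ++ h :: w ++ v) = T xi (p ++ w ++ h :: v).
Proof.
move=> oOm lin der; elim: w p => [//|x w IH] p /= sk us xi Omxi.
rewrite (seq_deriv_swap oOm lin der) //.
have E t : p ++ x :: t = rcons p x ++ t by rewrite cat_rcons.
rewrite !E; apply: IH => //; rewrite cat_rcons.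
  by move: sk; rewrite !size_cat.
move: us; rewrite !unit_seq_cat !unit_seq_cons.
by case: (unit_seq p) => //=; rewrite andbCA.
Qed.

Lemma seq_deriv_le nY k k' T Om : (k' <= k)%N -> @seq_deriv R W Z nY Om k T ->
  seq_deriv nY Om k' T.
Proof. by move=> kk der xi n Omxi nk; apply: der => //; exact: leq_trans kk. Qed.

Lemma seq_multilinB T T' : seq_multilin T -> seq_multilin T' ->
  seq_multilin (fun xi s => T xi s - T' xi s).
Proof.
by move=> lin lin' xi s1 s2 a x y; rewrite lin lin' scalerBr opprD addrACA.
Qed.

Lemma seq_derivB Om k T T' : seq_deriv (@enorm R Z) Om k T ->
  seq_deriv (@enorm R Z) Om k T' ->
  seq_deriv (@enorm R Z) Om k (fun xi s => T xi s - T' xi s).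
Proof.
move=> der der' xi n Omxi nk e e0; have e20 : 0 < e / 2 by rewrite divr_gt0.
have [d d0 dP] := der xi n Omxi nk _ e20.
have [d' d'0 d'P] := der' xi n Omxi nk _ e20.
exists (Num.min d d'); first by rewrite lt_min d0.
move=> h s sn us Omh; rewrite lt_min => /andP [hd hd'].
have := dP h s sn us Omh hd; have := d'P h s sn us Omh hd'.
rewrite !enorm_le => H' H; rewrite [A in A - _]subrACA [A in `|A|]subrACA.
by apply: le_trans (ler_normB _ _) _; lra.
Qed.

(** Allows a jet obtained from a norm bound to be identified with any other jet of the same
    function. *)
Lemma seq_deriv_eq k T T' Om : open Om ->
  seq_multilin T -> seq_deriv (@enorm R Z) Om k T ->
  seq_multilin T' -> seq_deriv (@enorm R Z) Om k T' ->
  (forall xi, Om xi -> T xi [::] = T' xi [::]) ->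
  forall s, (size s <= k)%N -> unit_seq s -> forall xi, Om xi -> T xi s = T' xi s.
Proof.
move=> oOm lin der lin' der' E0; elim=> [|h s IH] //= sk /andP [_ us] xi Omxi.
apply: (seq_deriv_unique _ oOm lin der lin' der') => // eta Ometa.
by apply: IH => //; exact: ltnW.
Qed.

End NormedJets.

(** Convexity in terms of a base point and an increment, the form required by the mean value
    inequality. *)
Definition segment_closed {R : realType} {W : normedModType R} (Om : set W) :=
  forall (x h : W) (th : R), Om x -> Om (x + h) -> 0 <= th <= 1 -> Om (x + th *: h).

(** * Increments, second differences and Taylor remainders of a jet *)

Section JetEstimates.
Context {R : realType} {W Z : normedModType R}.
Variables (delta1 : R) (Om : set W) (r : R) (T : W -> seq W -> Z) (M : R).
Hypotheses (delta1_le1 : delta1 <= 1) (segOm : segment_closed Om) (r_gt0 : 0 < r)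
  (jT : jet (@enorm R Z) delta1 Om r T M).
Implicit Types (xi h j : W) (s z : seq W) (al be ga : R).

Let lin := jet_multilin jT.
Let der := jet_deriv jT.
Let M0 := jet_ge0 jT.

Lemma jet_bound_norm xi s : Om xi -> (size s <= hk r)%N -> unit_seq s -> `|T xi s| <= M.
Proof. by move=> Oxi sk us; rewrite -enorm_le; exact: (jet_bound jT). Qed.

Lemma jet_bound_head xi h s : Om xi -> (size s < hk r)%N -> unit_seq s ->
  `|T xi (h :: s)| <= `|h| * M.
Proof.
move=> Oxi sk us; apply: (@homogeneous_bound _ _ _ (fun x => T xi (x :: s))).
  by move=> a x; exact: multilin_headZ.
by move=> x x1; apply: jet_bound_norm => //; rewrite unit_seq_cons x1.
Qed.

Lemma jet_lipschitz xi h s : Om xi -> Om (xi + h) -> (size s < hk r)%N -> unit_seq s ->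
  `|T (xi + h) s - T xi s| <= `|h| * M.
Proof.
move=> Oxi Oh sk us.
have seg (th : R) : 0 <= th <= 1 -> Om (xi + th *: h) by exact: segOm.
have := mean_value_ineq (M := `|h| * M) (path_deriv_seq lin der sk us seg).
rewrite scale1r scale0r addr0; apply=> th /seg Oth; exact: jet_bound_head.
Qed.

(** Below the top order the Lipschitz bound yields every exponent up to 1, because
    [|h| <= delta1 <= 1]; only at the top order is [be] limited by [ha r]. *)
Lemma jet_holder_le xi h s be : Om xi -> Om (xi + h) -> `|h| <= delta1 ->
  (size s <= hk r)%N -> unit_seq s -> 0 <= be <= 1 ->
  (size s = hk r -> be <= ha r) -> `|T (xi + h) s - T xi s| <= M * `|h| `^ be.
Proof.
move=> Oxi Oh hd sk us /andP [be0 be1] bek.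
have [->|h0] := eqVneq h 0; first by rewrite addr0 subrr normr0 mulr_ge0 // powR_ge0.
have h1 : `|h| <= 1 by exact: le_trans delta1_le1.
move: sk; rewrite leq_eqVlt => /predU1P [sk|sk]; last first.
  apply: le_trans (jet_lipschitz Oxi Oh sk us) _.
  by rewrite mulrC ler_wpM2l // le_powR_self.
have E : xi + h - xi = h by rewrite addrC addKr.
have := jet_holder jT r_gt0 Oh Oxi; rewrite E -subr_eq0 E => /(_ s h0 hd sk us).
rewrite enorm_le => /le_trans; apply; rewrite ler_wpM2l //.
by apply: le_powR_exp => //; rewrite ?normr_gt0 //; exact: bek.
Qed.

Let ha01 : 0 <= ha r <= 1. Proof. exact/ha_ge0_le1/ltW. Qed.

Lemma jet_second_diff1 xi h j z : Om xi -> Om (xi + h) -> Om (xi + j) -> Om (xi + j + h) ->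
  `|j| <= delta1 -> (size z < hk r)%N -> unit_seq z ->
  `|T (xi + j + h) z - T (xi + j) z - (T (xi + h) z - T xi z)|
     <= `|h| * (M * `|j| `^ ha r).
Proof.
move=> Oxi Oh Oj Ojh jd zk uz.
have seg (th : R) : 0 <= th <= 1 -> Om (xi + th *: h) by exact: segOm.
have segj (th : R) : 0 <= th <= 1 -> Om (xi + j + th *: h) by exact: segOm.
have := mean_value_ineq (M := `|h| * (M * `|j| `^ ha r))
  (path_derivB (path_deriv_seq lin der zk uz segj) (path_deriv_seq lin der zk uz seg)).
rewrite !scale1r !scale0r !addr0 subrACA; apply=> th th01.
apply: (@homogeneous_bound _ _ _
  (fun x => T (xi + j + th *: h) (x :: z) - T (xi + th *: h) (x :: z))).
  by move=> a x; rewrite !multilin_headZ // scalerBr.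
move=> x x1; rewrite addrAC; apply: jet_holder_le => //; first exact: seg.
  by rewrite addrAC; exact: segj.
by rewrite unit_seq_cons x1.
Qed.

(** The inequality on the exponents serves the orders below [hk r], the equality serves the top
    order. The factor 2 comes from the top order, where two Hoelder increments are added. *)
Lemma jet_second_diff xi h j z be ga : Om xi -> Om (xi + h) -> Om (xi + j) ->
  Om (xi + j + h) -> `|h| <= delta1 -> `|j| <= delta1 ->
  (size z <= hk r)%N -> unit_seq z -> 0 <= be <= 1 -> 0 <= ga <= 1 ->
  be + ga - 1 <= ha r -> (size z = hk r -> ha r = be + ga) ->
  `|T (xi + j + h) z - T (xi + j) z - (T (xi + h) z - T xi z)|
     <= 2 * M * (`|h| `^ ga * `|j| `^ be).
Proof.
move=> Oxi Oh Oj Ojh hd jd zk uz /andP [be0 be1] /andP [ga0 ga1] alge aleq.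
have B0 : 0 <= `|h| `^ ga * `|j| `^ be by rewrite mulr_ge0 // powR_ge0.
have [h0|h0] := eqVneq h 0.
  by rewrite h0 !addr0 !subrr normr0 !mulr_ge0 // powR_ge0.
have [j0|j0] := eqVneq j 0.
  by rewrite j0 !addr0 !subrr normr0 !mulr_ge0 // powR_ge0.
have nh0 : 0 < `|h| by rewrite normr_gt0.
have nj0 : 0 < `|j| by rewrite normr_gt0.
have h1 : `|h| <= 1 by exact: le_trans delta1_le1.
have j1 : `|j| <= 1 by exact: le_trans delta1_le1.
have Ohj : Om (xi + h + j) by rewrite addrAC.
move: zk; rewrite leq_eqVlt => /predU1P [zk|zk].
  have alE := aleq zk.
  have MM (x : R) : M * x + M * x = 2 * M * x by ring.
  have pD x : 0 < x -> x `^ ha r = x `^ ga * x `^ be.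
    by move=> x0; rewrite alE addrC powRD // (gt_eqF x0) implybT.
  have zk' : (size z <= hk r)%N by rewrite zk.
  have [hj|jh] := leP `|h| `|j|.
    apply: le_trans (ler_normB _ _) _.
    have H1 := jet_holder_le Oj Ojh hd zk' uz ha01 (fun=> lexx _).
    have H2 := jet_holder_le Oxi Oh hd zk' uz ha01 (fun=> lexx _).
    apply: le_trans (lerD H1 H2) _; rewrite MM ler_wpM2l ?mulr_ge0 //.
    by rewrite pD // ler_wpM2l ?powR_ge0 // ge0_ler_powR // nnegrE.
  (* With [j] the shorter direction, the difference is regrouped so that the increments are taken
     along [j]. *)
  rewrite subrACA [xi + j + h]addrAC; apply: le_trans (ler_normB _ _) _.
  have H1 := jet_holder_le Oh Ohj jd zk' uz ha01 (fun=> lexx _).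
  have H2 := jet_holder_le Oxi Oj jd zk' uz ha01 (fun=> lexx _).
  apply: le_trans (lerD H1 H2) _; rewrite MM ler_wpM2l ?mulr_ge0 //.
  by rewrite pD // ler_wpM2r ?powR_ge0 // ge0_ler_powR // ?nnegrE // ltW.
apply: (@le_trans _ _ (M * (`|h| `^ ga * `|j| `^ be))); last first.
  by rewrite ler_wpM2r // mulr_natl mulr2n lerDl.
have [hj|/ltW jh] := leP `|h| `|j|.
  apply: le_trans (jet_second_diff1 Oxi Oh Oj Ojh jd zk uz) _.
  by rewrite mulrCA ler_wpM2l // powR_interpolate.
rewrite subrACA [xi + j + h]addrAC.
apply: le_trans (jet_second_diff1 Oxi Oj Oh Ohj hd zk uz) _.
by rewrite mulrCA ler_wpM2l // [leRHS]mulrC powR_interpolate // (addrC ga).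
Qed.

Lemma jet_taylor xi h z : Om xi -> Om (xi + h) -> `|h| <= delta1 ->
  (size z < hk r)%N -> unit_seq z ->
  `|T (xi + h) z - T xi z - T xi (h :: z)| <= `|h| * (M * `|h| `^ ha r).
Proof.
move=> Oxi Oh hd zk uz.
have seg (th : R) : 0 <= th <= 1 -> Om (xi + th *: h) by exact: segOm.
have := mean_value_ineq (M := `|h| * (M * `|h| `^ ha r))
  (path_derivB (path_deriv_seq lin der zk uz seg) (path_deriv_scale (T xi (h :: z)))).
rewrite !scale1r !scale0r addr0 subr0 addrAC; apply=> th th01.
apply: (@homogeneous_bound _ _ _ (fun x => T (xi + th *: h) (x :: z) - T xi (x :: z))).
  by move=> a x; rewrite !multilin_headZ // scalerBr.
have thh : `|th *: h| <= `|h|.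
  by case/andP: th01 => th0 th1; rewrite normrZ ger0_norm // ler_piMl.
move=> x x1; apply: (@le_trans _ _ (M * `|th *: h| `^ ha r)).
  apply: jet_holder_le => //; [exact: seg|exact: le_trans hd|by rewrite unit_seq_cons x1].
by rewrite ler_wpM2l // ge0_ler_powR // ?nnegrE //; case/andP: ha01.
Qed.

(** Along [th *: h] the difference of the two remainders has as derivative a second difference of
    the next derivative; hence the top-order condition is on [(size z).+1]. *)
Lemma jet_taylor_diff xi h j z be ga : Om xi -> Om (xi + h) -> Om (xi + j) ->
  Om (xi + j + h) -> `|h| <= delta1 -> `|j| <= delta1 ->
  (size z < hk r)%N -> unit_seq z -> 0 <= be <= 1 -> 0 <= ga <= 1 ->
  be + ga - 1 <= ha r -> ((size z).+1 = hk r -> ha r = be + ga) ->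
  `|T (xi + j + h) z - T (xi + j) z - T (xi + j) (h :: z)
    - (T (xi + h) z - T xi z - T xi (h :: z))|
     <= `|h| * (2 * M * (`|h| `^ ga * `|j| `^ be)).
Proof.
move=> Oxi Oh Oj Ojh hd jd zk uz be01 ga01 alge aleq.
have seg (th : R) : 0 <= th <= 1 -> Om (xi + th *: h) by exact: segOm.
have segj (th : R) : 0 <= th <= 1 -> Om (xi + j + th *: h) by exact: segOm.
have := mean_value_ineq (M := `|h| * (2 * M * (`|h| `^ ga * `|j| `^ be)))
  (path_derivB (path_derivB (path_deriv_seq lin der zk uz segj)
     (path_deriv_seq lin der zk uz seg))
   (path_deriv_scale (T (xi + j) (h :: z) - T xi (h :: z)))).
rewrite !scale1r !scale0r !addr0 subr0 addrAC => H.
rewrite [A in `|A|]subrACA [A in A - _]subrACA; apply: H => th th01.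
have thh : `|th *: h| <= `|h|.
  by case/andP: th01 => th0 th1; rewrite normrZ ger0_norm // ler_piMl.
apply: (@homogeneous_bound _ _ _ (fun x =>
  T (xi + j + th *: h) (x :: z) - T (xi + th *: h) (x :: z) -
  (T (xi + j) (x :: z) - T xi (x :: z)))).
  by move=> a x; rewrite !multilin_headZ // !scalerBr.
move=> x x1; rewrite subrACA.
apply: (@le_trans _ _ (2 * M * (`|th *: h| `^ ga * `|j| `^ be))).
  apply: jet_second_diff => //; [exact: seg|exact: segj|exact: le_trans hd|].
  by rewrite unit_seq_cons x1.
rewrite ler_wpM2l ?mulr_ge0 // ler_wpM2r ?powR_ge0 //.
by rewrite ge0_ler_powR // ?nnegrE //; case/andP: ga01.
Qed.

(** The constant [M] is unchanged because Hoelder increments are measured only at distances at most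
    [delta1 <= 1]. *)
Lemma jet_le_exponent r' : 0 < r' -> r' <= r -> jet (@enorm R Z) delta1 Om r' T M.
Proof.
move=> r'0 r'r; have [kk ak] := hk_ha_mono r'0 r'r; split=> //.
- exact: seq_deriv_le kk der.
- by move=> xi s Oxi sk; apply: (jet_bound jT) => //; exact: leq_trans kk.
- move=> _ xi xi' s Oxi Oxi' _ xd sk us; rewrite enorm_le -{1}[xi](subrKC xi').
  apply: jet_holder_le => //; rewrite ?subrKC ?sk //; exact/ha_ge0_le1/ltW.
- by rewrite leNgt r'0.
Qed.

End JetEstimates.

(** * Differences of jets, and stability of the little Hoelder spaces under subtraction *)

Section LittleHolder.
Context {R : realType} {W Z : normedModType R}.
Variables (delta1 : R) (Om : set W).
Implicit Types (r s M : R) (T : W -> seq W -> Z) (phi psi : W -> Z).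

Lemma jetB s T T' M M' : jet (@enorm R Z) delta1 Om s T M ->
  jet (@enorm R Z) delta1 Om s T' M' ->
  jet (@enorm R Z) delta1 Om s (fun xi w => T xi w - T' xi w) (M + M').
Proof.
move=> jT jT'; split.
- exact: addr_ge0 (jet_ge0 jT) (jet_ge0 jT').
- exact: seq_multilinB (jet_multilin jT) (jet_multilin jT').
- exact: seq_derivB (jet_deriv jT) (jet_deriv jT').
- move=> xi w Oxi wk uw; rewrite enorm_le; apply: le_trans (ler_normB _ _) _.
  by apply: lerD; rewrite -enorm_le; [apply: (jet_bound jT)|apply: (jet_bound jT')].
- move=> s0 xi xi' w Oxi Oxi' xx' xd wk uw; rewrite enorm_le subrACA mulrDl.
  apply: le_trans (ler_normB _ _) _; apply: lerD; rewrite -enorm_le.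
    exact: (jet_holder jT).
  exact: (jet_holder jT').
- move=> s0 xi Oxi e e0; have e20 : 0 < e / 2 by rewrite divr_gt0.
  have [d d0 dP] := jet_cont jT s0 Oxi e20.
  have [d' d'0 d'P] := jet_cont jT' s0 Oxi e20.
  exists (Num.min d d'); first by rewrite lt_min d0.
  move=> xi' Oxi'; rewrite lt_min => /andP [xd xd'].
  have := dP _ Oxi' xd; have := d'P _ Oxi' xd'; rewrite /enorm !lte_fin subrACA => H1 H2.
  by apply: le_lt_trans (ler_normB _ _) _; lra.
Qed.

(** [jetB] adds the constants crudely; this keeps its qualitative content and installs a sharper
    constant. *)
Lemma jet_bound_change s T M M' : jet (@enorm R Z) delta1 Om s T M -> 0 <= M' ->
  (forall xi w, Om xi -> (size w <= hk s)%N -> unit_seq w -> `|T xi w| <= M') ->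
  (0 < s -> forall xi j w, Om xi -> Om (xi + j) -> `|j| <= delta1 ->
     size w = hk s -> unit_seq w -> `|T (xi + j) w - T xi w| <= M' * `|j| `^ ha s) ->
  jet (@enorm R Z) delta1 Om s T M'.
Proof.
move=> jT M'0 bd hol; split=> //.
- exact: jet_multilin jT.
- exact: jet_deriv jT.
- move=> s0 xi xi' w Oxi Oxi' _ xd wk uw; rewrite enorm_le -{1}[xi](subrKC xi').
  by apply: hol => //; rewrite subrKC.
- exact: jet_cont jT.
Qed.

Lemma inC_jet r phi : 0 <= r -> inC (@enorm R Z) delta1 Om r phi ->
  exists M T, jet (@enorm R Z) delta1 Om r T M /\ forall xi, T xi [::] = phi xi.
Proof.
move=> r0 Cphi; have [M /(Cnorm_jet r0) [T jT E]] : exists M,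
    (Cnorm (@enorm R Z) delta1 Om r phi < M%:E)%E.
  move: Cphi; rewrite /inC; case: (Cnorm _ _ _ _ _) => [x _|//|_].
    by exists (x + 1); rewrite lte_fin ltrDl.
  by exists 0; rewrite ltNyr.
by exists M, T.
Qed.

Lemma jet_inC r phi T M : jet (@enorm R Z) delta1 Om r T M ->
  (forall xi, Om xi -> T xi [::] = phi xi) -> inC (@enorm R Z) delta1 Om r phi.
Proof. by move=> jT E; apply: le_lt_trans (jet_Cnorm jT E) _; rewrite ltry. Qed.

Lemma inCB r phi psi : 0 <= r -> inC (@enorm R Z) delta1 Om r phi ->
  inC (@enorm R Z) delta1 Om r psi ->
  inC (@enorm R Z) delta1 Om r (fun xi => phi xi - psi xi).
Proof.
move=> r0 /(inC_jet r0) [M [T [jT E]]] /(inC_jet r0) [M' [T' [jT' E']]].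
by apply: (jet_inC (jetB jT jT')) => xi _; rewrite E E'.
Qed.

Hypotheses (delta1_le1 : delta1 <= 1) (segOm : segment_closed Om).

Lemma inC_le r r' phi : 0 < r' -> r' <= r -> inC (@enorm R Z) delta1 Om r phi ->
  inC (@enorm R Z) delta1 Om r' phi.
Proof.
move=> r'0 r'r; have r0 : 0 < r by exact: lt_le_trans r'r.
move=> /(inC_jet (ltW r0)) [M [T [jT E]]].
by apply: (jet_inC (jet_le_exponent delta1_le1 segOm r0 jT r'0 r'r)) => xi _.
Qed.

Lemma incB s phi psi : 0 <= s -> inc (@enorm R Z) delta1 Om s phi ->
  inc (@enorm R Z) delta1 Om s psi ->
  inc (@enorm R Z) delta1 Om s (fun xi => phi xi - psi xi).
Proof.
move=> s0 [Cphi aphi] [Cpsi apsi]; split; first exact: inCB.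
(* Thirds, because [jet_Cnorm] gives only a weak inequality and the sum must stay strictly below
   [e]. *)
move=> e e0; have e30 : 0 < e / 3 by rewrite divr_gt0.
have [r1 [sr1 [f [Cf fe]]]] := aphi _ e30.
have [r2 [sr2 [g [Cg ge]]]] := apsi _ e30.
(* The two approximants may have different regularity; both lie in the space of the smaller
   exponent. *)
pose r' := Num.min r1 r2; have sr' : s < r' by rewrite lt_min sr1.
have r'0 : 0 < r' by exact: le_lt_trans sr'.
exists r'; split=> //; exists (fun xi => f xi - g xi); split.
  by apply: inCB; [exact: ltW|exact: inC_le (ge_minl _ _) Cf|exact: inC_le (ge_minr _ _) Cg].
have [T jT E] := Cnorm_jet s0 fe; have [T' jT' E'] := Cnorm_jet s0 ge.
have := jet_Cnorm (jetB jT jT') (phi := fun xi => phi xi - psi xi - (f xi - g xi)).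
move=> H; apply: le_lt_trans (H _) _; first by move=> xi _; rewrite E E' subrACA.
by rewrite lte_fin; lra.
Qed.

End LittleHolder.

(** * Restriction of a jet on the product to the two factors *)

Section Slices.
Context {R : realType} {BU BV Z : normedModType R}.
Implicit Types (T : BU * BV -> seq (BU * BV) -> Z) (u : BU) (x : BV)
  (v : seq BU) (w : seq BV).

(** The head of a list is the last differentiation, so placing the [BV] directions first makes
    [slice T u v] the jet in [x] of the partial derivative of [phi] in the directions [v]. *)
Definition slice T u v x w := T (u, x) ([seq (0, y) | y <- w] ++ [seq (y, 0) | y <- v]).

Lemma norm_pairl (y : BU) : `|(y, 0) : BU * BV| = `|y|.
Proof. by rewrite prod_normE /= normr0 max_l. Qed.

Lemma norm_pairr (y : BV) : `|(0, y) : BU * BV| = `|y|.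
Proof. by rewrite prod_normE /= normr0 max_r. Qed.

Lemma unit_seq_pairl v : unit_seq [seq (y, 0 : BV) | y <- v] = unit_seq v.
Proof. by rewrite /unit_seq all_map; apply: eq_all => y; rewrite /= norm_pairl. Qed.

Lemma unit_seq_pairr w : unit_seq [seq (0 : BU, y) | y <- w] = unit_seq w.
Proof. by rewrite /unit_seq all_map; apply: eq_all => y; rewrite /= norm_pairr. Qed.

Lemma addr_pairl u u' x : (u + u', x) = (u, x) + (u', 0).
Proof. by apply: injective_projections; rewrite /= ?addr0. Qed.

Lemma addr_pairr u x x' : (u, x + x') = (u, x) + (0, x').
Proof. by apply: injective_projections; rewrite /= ?addr0. Qed.

Lemma slice_multilin T u v : seq_multilin T -> seq_multilin (slice T u v).
Proof.
move=> lin x s1 s2 a y y'; rewrite /slice !map_cat /= -!catA !cat_cons.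
have -> : (0, a *: y + y') = a *: (0, y) + (0, y') :> BU * BV.
  by apply: injective_projections; rewrite /= ?scaler0 ?addr0.
exact: lin.
Qed.

End Slices.

(** * Estimates in the [s]-norm for partial derivatives in [u] *)

Section ProductJets.
Context {R : realType} {BU BV Z : normedModType R}.
Variables (delta1 : R) (U : set BU) (V : set BV) (r s : R).
Variables (T : BU * BV -> seq (BU * BV) -> Z) (M : R).
Hypotheses (delta1_gt0 : 0 < delta1) (delta1_le1 : delta1 <= 1)
  (oUV : open (U `*` V)) (segUV : segment_closed (U `*` V)).
Hypotheses (s_ge0 : 0 <= s) (t_gt0 : 0 < r - s).
Hypothesis jT : jet (@enorm R Z) delta1 (U `*` V) r T M.
Implicit Types (u h : BU) (x j : BV) (v : seq BU) (w : seq BV).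

Let M0 : 0 <= M := jet_ge0 jT.
Let lin := jet_multilin jT.
Let der := jet_deriv jT.
Let r_gt0 : 0 < r. Proof. by move: s_ge0 t_gt0; lra. Qed.
Let be01 : 0 <= ha s <= 1. Proof. exact: ha_ge0_le1. Qed.
Let ga01 : 0 <= ha (r - s) <= 1. Proof. exact/ha_ge0_le1/ltW. Qed.
Let al01 : 0 <= ha r <= 1. Proof. exact/ha_ge0_le1/ltW. Qed.

Let dirs w v : seq (BU * BV) := [seq (0, y) | y <- w] ++ [seq (y, 0) | y <- v].

Let size_dirs w v : size (dirs w v) = (size w + size v)%N.
Proof. by rewrite size_cat !size_map. Qed.

Let unit_dirs w v : unit_seq w -> unit_seq v -> unit_seq (dirs w v).
Proof. by move=> uw uv; rewrite /dirs unit_seq_cat unit_seq_pairr unit_seq_pairl uw. Qed.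

Let order_le w v : (size w <= hk s)%N -> (size v <= hk (r - s))%N ->
  (size (dirs w v) <= hk r)%N.
Proof.
move=> wl vm; have [lm _ _] := hk_ha_split s_ge0 t_gt0.
by rewrite size_dirs; exact: leq_trans (leq_add wl vm) lm.
Qed.

(** The top order is reached only if [hk s + hk (r - s)] exhausts [hk r], the case in which the
    fractional parts add. *)
Let order_eq w v : (size w <= hk s)%N -> (size v <= hk (r - s))%N ->
  size (dirs w v) = hk r -> ha r = ha s + ha (r - s).
Proof.
move=> wl vm; have [lm aE _] := hk_ha_split s_ge0 t_gt0.
rewrite size_dirs => wv; apply: aE; apply/eqP.
by rewrite eqn_leq lm -wv; exact: leq_add.
Qed.

Lemma slice_jet u v : U u -> unit_seq v -> (size v <= hk (r - s))%N ->
  jet (@enorm R Z) delta1 V s (slice T u v) M.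
Proof.
move=> Uu uv vm; have /andP [be0 be1] := be01; have /andP [ga0 ga1] := ga01.
split=> //.
- exact: slice_multilin.
- move=> x n Vx nl e e0.
  have UVx : (U `*` V) (u, x) by [].
  have nk : (n + size v < hk r)%N.
    by have [lm _ _] := hk_ha_split s_ge0 t_gt0; exact: leq_trans (leq_add nl vm) lm.
  have [d d0 dP] := der UVx nk e0; exists d => // h w wn uw Vh hd.
  have := dP (0, h) (dirs w v); rewrite size_dirs wn norm_pairr -addr_pairr.
  by apply=> //; exact: unit_dirs.
- move=> x w Vx wl uw; apply: (jet_bound jT) => //; first exact: order_le.
  exact: unit_dirs.
- move=> _ x x' w Vx Vx' _ xd wl uw; rewrite enorm_le /slice -/(dirs w v).
  rewrite -{1}[x](subrKC x') addr_pairr -(@norm_pairr _ BU _ (x - x')).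
  apply: (jet_holder_le delta1_le1 segUV r_gt0 jT) => //.
  + by rewrite -addr_pairr subrKC.
  + by rewrite norm_pairr.
  + by apply: order_le => //; rewrite wl.
  + exact: unit_dirs.
  + by move/order_eq => -> //; rewrite ?wl //; lra.
- move=> _ x Vx e e0.
  (* For [s = 0] continuity follows from the bound with exponent [ha r]. [M + 1] allows [M = 0], and
     halving [e] makes the final inequality strict. *)
  have e1 : 0 < e / 2 / (M + 1) by rewrite !divr_gt0 // ltr_wpDl.
  have [d d0 dP] := powR_small (ha_gt0 r_gt0) e1.
  exists (Num.min d delta1); first by rewrite lt_min d0.
  move=> x' Vx' xd; rewrite /enorm lte_fin /slice -/(dirs [::] v).
  rewrite -{1}[x'](subrKC x) addr_pairr.
  move: xd; rewrite distrC lt_min => /andP [xd xd1].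
  apply: (@le_lt_trans _ _ (M * `|(0, x' - x) : BU * BV| `^ ha r)).
    apply: (jet_holder_le delta1_le1 segUV r_gt0 jT) => //.
    + by rewrite -addr_pairr subrKC.
    + by rewrite norm_pairr ltW.
    + exact: order_le.
    + exact: unit_dirs.
  rewrite norm_pairr; apply: (@le_lt_trans _ _ ((M + 1) * (e / 2 / (M + 1)))).
    by apply: ler_pM; rewrite ?powR_ge0 ?lerDl // dP // ltW.
  by rewrite mulrC divfK ?gt_eqF ?ltr_wpDl //; lra.
Qed.

(** The sup bounds are increments in [u] with exponent [ha (r - s)]; the Hoelder bound in [x] is a
    second difference, which accounts for the factor 2. *)
Lemma slice_diff_jet u h v : U u -> U (u + h) -> `|h| <= delta1 -> unit_seq v ->
  size v = hk (r - s) ->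
  jet (@enorm R Z) delta1 V s (fun x w => slice T (u + h) v x w - slice T u v x w)
    (2 * M * `|h| `^ ha (r - s)).
Proof.
move=> Uu Uh hd uv vm; have vm' : (size v <= hk (r - s))%N by rewrite vm.
have [_ _ alge] := hk_ha_split s_ge0 t_gt0; have /andP [be0 be1] := be01.
have h0 : 0 <= M * `|h| `^ ha (r - s) by rewrite mulr_ge0 // powR_ge0.
apply: jet_bound_change (jetB (slice_jet Uh uv vm') (slice_jet Uu uv vm')) _ _ _.
- by rewrite -mulrA mulr_ge0.
- move=> x w Vx wl uw; apply: (@le_trans _ _ (M * `|h| `^ ha (r - s))); last by lra.
  rewrite /slice -/(dirs w v) addr_pairl -(@norm_pairl _ _ BV h).
  apply: (jet_holder_le delta1_le1 segUV r_gt0 jT) => //.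
  + by rewrite -addr_pairl.
  + by rewrite norm_pairl.
  + exact: order_le.
  + exact: unit_dirs.
  + by move/order_eq => -> //; lra.
- move=> s_gt0 x j w Vx Vj jd wl uw; have wl' : (size w <= hk s)%N by rewrite wl.
  have := @jet_second_diff _ _ _ _ _ _ _ _ delta1_le1 segUV r_gt0 jT (u, x) (h, 0) (0, j)
    (dirs w v) (ha s) (ha (r - s)).
  rewrite -!addr_pairr -!addr_pairl norm_pairl norm_pairr mulrA; apply=> //.
  + exact: order_le.
  + exact: unit_dirs.
  + exact: order_eq.
Qed.

(** The first-order remainder in [u], differentiated in [x], is again a Taylor remainder once [h]
    has been moved to the front. [jet_taylor] bounds its size and [jet_taylor_diff] its increments
    in [x]. *)
Lemma slice_deriv_jet u n : U u -> (n < hk (r - s))%N -> forall e : R, 0 < e ->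
  exists2 d : R, 0 < d & forall h v, size v = n -> unit_seq v -> U (u + h) -> `|h| < d ->
  jet (@enorm R Z) delta1 V s
    (fun x w => slice T (u + h) v x w - slice T u v x w - slice T u (h :: v) x w)
    (e * `|h|).
Proof.
move=> Uu nm e e0.
have e1 : 0 < e / (2 * M + 1) by rewrite divr_gt0 // ltr_wpDl // mulr_ge0.
have [d1 d10 d1P] := powR_small (ha_gt0 r_gt0) e1.
have [d2 d20 d2P] := powR_small (ha_gt0 t_gt0) e1.
(* [d1] controls the sup part, with exponent [ha r]; [d2] the Hoelder part, with exponent
   [ha (r - s)]. The bound by [delta1 <= 1] makes [h :: v] a list of unit directions. *)
exists (Num.min delta1 (Num.min d1 d2)); first by rewrite !lt_min delta1_gt0 d10.
move=> h v vn uv Uh; rewrite !lt_min => /and3P [/ltW hd /ltW hd1 /ltW hd2].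
have vm : (size v < hk (r - s))%N by rewrite vn.
have h1 : `|h| <= 1 by exact: le_trans delta1_le1.
have uhv : unit_seq (h :: v) by rewrite unit_seq_cons h1.
have [lmk _ alge] := hk_ha_split s_ge0 t_gt0.
have small p : 0 <= p -> p <= e / (2 * M + 1) -> 2 * M * p <= e.
  move=> p0 pe; apply: (@le_trans _ _ ((2 * M + 1) * (e / (2 * M + 1)))).
    by apply: ler_pM; rewrite ?mulr_ge0 // lerDl.
  by rewrite mulrC divfK // gt_eqF // ltr_wpDl // mulr_ge0.
have swap x w : V x -> (size w <= hk s)%N -> unit_seq w ->
    slice T u (h :: v) x w = T (u, x) ((h, 0) :: dirs w v).
  move=> Vx wl uw; have H := @seq_deriv_move _ _ _ _ _ _ (h, 0) [::]
    [seq (0, y) | y <- w] [seq (y, 0) | y <- v] oUV lin der.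
  apply/esym/H => //; last by rewrite cat0s unit_seq_cons norm_pairl h1; exact: unit_dirs.
  by rewrite /= size_cat !size_map -addnS; exact: leq_trans (leq_add wl vm) lmk.
have order_lt w : (size w <= hk s)%N -> (size (dirs w v) < hk r)%N.
  by move=> wl; rewrite size_dirs -addnS; exact: leq_trans (leq_add wl vm) lmk.
apply: jet_bound_change
  (jetB (jetB (slice_jet Uh uv (ltnW vm)) (slice_jet Uu uv (ltnW vm)))
        (slice_jet Uu uhv vm)) _ _ _.
- by rewrite mulr_ge0 // ltW.
- move=> x w Vx wl uw; rewrite swap // /slice -/(dirs w v) addr_pairl.
  apply: le_trans (jet_taylor delta1_le1 segUV r_gt0 jT _ _ _ _ _) _ => //.
  + by rewrite -addr_pairl.
  + by rewrite norm_pairl.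
  + exact: order_lt.
  + exact: unit_dirs.
  rewrite norm_pairl mulrC ler_wpM2r //.
  apply: le_trans (small _ (powR_ge0 _ _) (d1P _ (normr_ge0 _) hd1)).
  by rewrite ler_wpM2r ?powR_ge0 // mulr_natl mulr2n lerDl.
- move=> s_gt0 x j w Vx Vj jd wl uw; have wl' : (size w <= hk s)%N by rewrite wl.
  rewrite !swap //.
  have := @jet_taylor_diff _ _ _ _ _ _ _ _ delta1_le1 segUV r_gt0 jT (u, x) (h, 0) (0, j)
    (dirs w v) (ha s) (ha (r - s)).
  rewrite -!addr_pairr -!addr_pairl norm_pairl norm_pairr => H.
  apply: le_trans (H _ _ _ _ _ _ _ _ _ _ _ _) _ => //.
  + exact: order_lt.
  + exact: unit_dirs.
  + move=> E; apply: (@order_eq w (h :: v)) => //.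
    by rewrite size_dirs /= addnS -size_dirs.
  rewrite [leRHS]mulrAC [leRHS]mulrC ler_wpM2l // mulrA ler_wpM2r ?powR_ge0 //.
  exact: small (powR_ge0 _ _) (d2P _ (normr_ge0 _) hd2).
Qed.

End ProductJets.

(** * The jet of the curried map with values in [C^s] and [c^s] *)

Section Currying.
Context {R : realType} {BU BV Z : normedModType R}.
Variables (delta1 : R) (U : set BU) (V : set BV) (s : R).
Hypotheses (delta1_gt0 : 0 < delta1) (delta1_le1 : delta1 <= 1)
  (oUV : open (U `*` V)) (segUV : segment_closed (U `*` V)) (segV : segment_closed V).
Hypothesis s_ge0 : 0 <= s.
Implicit Types (r M : R) (T : BU * BV -> seq (BU * BV) -> Z) (phi psi : BU * BV -> Z).

Definition curry_jet T (u : BU) (v : seq BU) : BV -> Z := fun x => slice T u v x [::].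

(** An identity between functions on all of [BV], so multilinearity of [T] is used at points off the
    domain too. *)
Lemma curry_jet_multilin T : seq_multilin T -> seq_multilin (curry_jet T).
Proof.
move=> lin u s1 s2 a y y'; apply/funext => x.
rewrite /curry_jet /slice /= !map_cat /=.
have -> : (a *: y + y', 0) = a *: (y, 0) + (y', 0) :> BU * BV.
  by apply: injective_projections; rewrite /= ?scaler0 ?addr0.
exact: lin.
Qed.

(** Through [jet_Cnorm], each jet estimate in [x] becomes an estimate of a [C^s] norm of values. *)
Lemma jet_curry r T M : 0 < r - s -> jet (@enorm R Z) delta1 (U `*` V) r T M ->
  jet (Cnorm (@enorm R Z) delta1 V s) delta1 U (r - s) (curry_jet T) (2 * M).
Proof.
move=> t0 jT; have M0 := jet_ge0 jT; split.
- by rewrite mulr_ge0.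
- exact/curry_jet_multilin/(jet_multilin jT).
- move=> u n Uu nm e e0.
  have [d d0 dP] := slice_deriv_jet delta1_gt0 delta1_le1 oUV segUV s_ge0 t0 jT Uu nm e0.
  by exists d => // h v vn uv Uh hd; apply: jet_Cnorm (dP h v vn uv Uh hd) _.
- move=> u v Uu vm uv.
  apply: le_trans (jet_Cnorm (slice_jet delta1_gt0 delta1_le1 segUV s_ge0 t0 jT Uu uv vm) _) _.
    by [].
  by rewrite lee_fin mulr_natl mulr2n lerDl.
- move=> _ u u' v Uu Uu' _ ud vm uv.
  have Uh : U (u' + (u - u')) by rewrite subrKC.
  have := slice_diff_jet delta1_gt0 delta1_le1 segUV s_ge0 t0 jT Uu' Uh ud uv vm.
  by rewrite subrKC => /jet_Cnorm; apply.
- by rewrite leNgt t0.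
Qed.

Lemma curry_jet_inc r phi T M : 0 < r - s -> inc (@enorm R Z) delta1 (U `*` V) r phi ->
  jet (@enorm R Z) delta1 (U `*` V) r T M ->
  (forall p, T p [::] = phi p) ->
  forall u v, U u -> unit_seq v -> (size v <= hk (r - s))%N ->
  inc (@enorm R Z) delta1 V s (curry_jet T u v).
Proof.
move: (s_ge0) => s0 t0 [_ aphi] jT E u v Uu uv vm; have r0 : 0 < r by lra.
split.
  by apply: (jet_inC (slice_jet delta1_gt0 delta1_le1 segUV s_ge0 t0 jT Uu uv vm)).
move=> e e0; have [r' [rr' [psi [Cpsi psie]]]] := aphi _ (divr_gt0 e0 (ltr0n _ 2)).
have r'0 : 0 <= r' by lra.
have [M1 [T1 [jT1 E1]]] := inC_jet r'0 Cpsi.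
have [T2 jT2 E2] := Cnorm_jet (ltW r0) psie.
(* Raising [r] and [s] by the same amount keeps the difference, so the same lists [v] are admissible
   for [psi]. *)
have tE : r' - (r' - (r - s)) = r - s by lra.
have s'0 : 0 <= r' - (r - s) by lra.
have t0' : 0 < r' - (r' - (r - s)) by rewrite tE.
exists (r' - (r - s)); split; first by lra.
exists (curry_jet T1 u v); split.
  apply: (jet_inC (slice_jet delta1_gt0 delta1_le1 segUV s'0 t0' jT1 Uu uv _)) => //.
  by rewrite tE.
apply: le_lt_trans (jet_Cnorm
  (slice_jet delta1_gt0 delta1_le1 segUV s_ge0 t0 jT2 Uu uv vm) _) _; last first.
  by rewrite lte_fin; lra.
(* The small constant belongs to [T2], obtained from the norm of [phi - psi]; uniqueness of
   derivatives identifies it with [T - T1]. *)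
move=> x Vx; rewrite /curry_jet /slice.
have [kk _] := hk_ha_mono r0 (ltW rr').
have [lm _ _] := hk_ha_split s_ge0 t0.
apply: (seq_deriv_eq oUV (jet_multilin jT2) (jet_deriv jT2)
  (seq_multilinB (jet_multilin jT) (jet_multilin jT1))
  (seq_derivB (jet_deriv jT) (seq_deriv_le kk (jet_deriv jT1)))).
- by move=> p _; rewrite E E1 E2.
- by rewrite /= size_map (leq_trans vm) // (leq_trans _ lm) // leq_addl.
- by rewrite /= unit_seq_pairl.
- by [].
Qed.

Lemma restrnormE (Y : Type) (P : Y -> Prop) (n : Y -> \bar R) y :
  P y -> restrnorm P n y = n y.
Proof.
move=> Py; rewrite /restrnorm; have -> : [set N | P y /\ N = n y] = [set n y].
  by apply/seteqP; split=> [N [_ ->]|_ ->].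
exact: ereal_inf1.
Qed.

(** On [c^s] the restricted norm is the [C^s] norm, so only membership of the differences of values
    has to be added. *)
Lemma jet_curry_inc r phi T M : 0 < r - s -> inc (@enorm R Z) delta1 (U `*` V) r phi ->
  jet (@enorm R Z) delta1 (U `*` V) r T M ->
  (forall p, T p [::] = phi p) ->
  jet (restrnorm (inc (@enorm R Z) delta1 V s) (Cnorm (@enorm R Z) delta1 V s))
    delta1 U (r - s) (curry_jet T) (2 * M).
Proof.
move=> t0 cphi jT E; have [M0 lin der bd hol _] := jet_curry t0 jT.
have ic := curry_jet_inc t0 cphi jT E; split=> //.
- move=> u n Uu nm e e0; have [d d0 dP] := der u n Uu nm e e0.
  (* The cap 1 makes [h :: v] admissible in [curry_jet_inc]. *)
  exists (Num.min 1 d); first by rewrite lt_min ltr01.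
  move=> h v vn uv Uh; rewrite lt_min => /andP [/ltW h1 hd]; rewrite restrnormE; first exact: dP.
  have vm : (size v <= hk (r - s))%N by rewrite vn ltnW.
  apply: incB => //; last by apply: ic => //=; rewrite ?unit_seq_cons ?h1 ?vn.
  by apply: incB => //; exact: ic.
- by move=> u v Uu vm uv; rewrite restrnormE; [exact: bd|exact: ic].
- move=> _ u u' v Uu Uu' uu' ud vm uv; rewrite restrnormE; first exact: hol.
  by apply: incB => //; apply: ic => //; rewrite vm.
- by rewrite leNgt t0.
Qed.

End Currying.

(** * Convex and open products, and the two embeddings *)

Lemma convex_segment_closed (R : realType) (B : normedModType R) (A : set B) :
  convex_set (A : set (convex_lmodType B)) -> segment_closed A.
Proof.
move=> cA x h th Ax Ah /andP [th0 th1].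
have := cA (x + h) x (Itv01 th0 th1); rewrite !inE => /(_ Ah Ax); rewrite /conv /=.
suff -> : th *: (x + h) + (1 - th) *: x = x + th *: h by [].
by rewrite scalerDr scalerBl scale1r addrC addrA subrK.
Qed.

Lemma segment_closedX (R : realType) (A B : normedModType R) (U : set A) (V : set B) :
  segment_closed U -> segment_closed V -> segment_closed (U `*` V).
Proof. by move=> sU sV x h th [Ux Vx] [Uh Vh] th01; split; [exact: sU|exact: sV]. Qed.

Lemma open_setX (A B : topologicalType) (U : set A) (V : set B) :
  open U -> open V -> open (U `*` V).
Proof.
move=> oU oV; rewrite openE => -[u x] [Uu Vx]; exists (U, V) => //.
by split; apply: open_nbhs_nbhs.
Qed.

Theorem theoremC2 (R : realType) (delta1 : R)
    (BU BV Z : completeNormedModType R)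
    (U : set BU) (V : set BV) (r s : R) :
  0 < delta1 -> delta1 <= 1 ->
  open U -> convex_set (U : set (convex_lmodType BU)) ->
  open V -> convex_set (V : set (convex_lmodType BV)) ->
  0 <= r -> 0 <= s -> 0 < r - s ->
  let t := r - s in
  (* ||.||_r on C^r(U x V; Z), with B_U x B_V carrying the max norm *)
  let NCr := Cnorm (@enorm R Z) delta1 (U `*` V) r in
  let inCr := inC (@enorm R Z) delta1 (U `*` V) r in
  let incr := inc (@enorm R Z) delta1 (U `*` V) r in
  (* ||.||_s on C^s(V; Z) (+oo outside C^s(V;Z)), and its restriction to c^s *)
  let NCs : (BV -> Z) -> \bar R := Cnorm (@enorm R Z) delta1 V s in
  let Ncs : (BV -> Z) -> \bar R :=
    restrnorm (inc (@enorm R Z) delta1 V s) NCs in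
  (* C^t(U; C^s(V;Z)) and C^t(U; c^s(V;Z)) *)
  let NCtCs := Cnorm NCs delta1 U t in
  let NCtcs := Cnorm Ncs delta1 U t in
  (* first injection: C^r(U x V; Z) -> C^t(U; C^s(V; Z)) *)
  [/\ (forall phi, inCr phi -> inC NCs delta1 U t (hat phi)),
      (forall (a : R) (phi psi : BU * BV -> Z) u x,
         hat (fun p => a *: phi p + psi p) u x = a *: hat phi u x + hat psi u x),
      (forall phi psi, inCr phi -> inCr psi ->
         (forall u, U u -> forall x, V x -> hat phi u x = hat psi u x) ->
         forall p, (U `*` V) p -> phi p = psi p)
    & (forall phi, inCr phi -> forall eps : R, 0 < eps ->
         exists2 del : R, 0 < del & forall psi, inCr psi ->
           (NCr (fun p => (phi p - psi p)%R) < del%:E)%E ->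
           (NCtCs (fun u x => (hat phi u x - hat psi u x)%R) < eps%:E)%E)]
  /\
  (* second injection: c^r(U x V; Z) -> C^t(U; c^s(V; Z)) *)
  [/\ (forall phi, incr phi -> inC Ncs delta1 U t (hat phi)),
      (forall (a : R) (phi psi : BU * BV -> Z) u x,
         hat (fun p => a *: phi p + psi p) u x = a *: hat phi u x + hat psi u x),
      (forall phi psi, incr phi -> incr psi ->
         (forall u, U u -> forall x, V x -> hat phi u x = hat psi u x) ->
         forall p, (U `*` V) p -> phi p = psi p)
    & (forall phi, incr phi -> forall eps : R, 0 < eps ->
         exists2 del : R, 0 < del & forall psi, incr psi ->
           (NCr (fun p => (phi p - psi p)%R) < del%:E)%E ->
           (NCtcs (fun u x => (hat phi u x - hat psi u x)%R) < eps%:E)%E)].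
Proof.
move=> d0 d1 oU cU oV cV r0 s0 t0 t NCr inCr incr NCs Ncs NCtCs NCtcs.
have sV := convex_segment_closed cV.
have sUV := segment_closedX (convex_segment_closed cU) sV.
have oUV := open_setX oU oV.
(* Currying has norm at most 2. As [hat] commutes with differences, continuity follows by applying
   this bound to [phi - psi], and [e / 3] gives [2 * (e / 3) < e]. *)
have CE (phi : BU * BV -> Z) M : (NCr phi < M%:E)%E -> (NCtCs (hat phi) <= (2 * M)%:E)%E.
  move=> /(Cnorm_jet r0) [T jT E].
  apply: jet_Cnorm (jet_curry d0 d1 oUV sUV s0 t0 jT) _ => u _.
  by apply/funext => x; exact: E.
have cE (phi : BU * BV -> Z) M : incr phi -> (NCr phi < M%:E)%E ->
    (NCtcs (hat phi) <= (2 * M)%:E)%E.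
  move=> cphi /(Cnorm_jet r0) [T jT E].
  apply: jet_Cnorm (jet_curry_inc d0 d1 oUV sUV sV s0 t0 cphi jT E) _ => u _.
  by apply/funext => x; exact: E.
split; split=> //.
- move=> phi /(inC_jet r0) [M [T [jT E]]].
  apply: le_lt_trans (jet_Cnorm (jet_curry d0 d1 oUV sUV s0 t0 jT) _) (ltry _) => u _.
  by apply/funext => x; exact: E.
- by move=> phi psi _ _ E [u x] [Uu Vx]; exact: E.
- move=> phi _ e e0; exists (e / 3) => [|psi _ H]; first by rewrite divr_gt0.
  by apply: le_lt_trans (CE _ _ H) _; rewrite lte_fin; lra.
- move=> phi cphi; have [/(inC_jet r0) [M [T [jT E]]] _] := cphi.
  apply: le_lt_trans (jet_Cnorm (jet_curry_inc d0 d1 oUV sUV sV s0 t0 cphi jT E) _)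
    (ltry _) => u _.
  by apply/funext => x; exact: E.
- by move=> phi psi _ _ E [u x] [Uu Vx]; exact: E.
- move=> phi cphi e e0; exists (e / 3) => [|psi cpsi H]; first by rewrite divr_gt0.
  apply: le_lt_trans (cE _ _ (incB d1 sUV r0 cphi cpsi) H) _; rewrite lte_fin; lra.
Qed.
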